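(* Let $A\in\mathbb{C}^{n\times n}$ be a non-Hermitian, nondefective (i.e. diagonalizable) matrix. Let $V$ be a nonsingular matrix such that $\Lambda=V^{-1}AV$ is the diagonal matrix of eigenvalues of $A$, and assume these eigenvalues are real and ordered as $\lambda_{1}\leq\cdots\leq\lambda_{n}$. Then: (1) $\lambda_{1}\,y^{*}x\leq y^{*}Ax\leq \lambda_{n}\,y^{*}x$ for all $x\in\mathbb{C}^{n}$ and $y=(VV^{*})^{-1}x$; (2) $$\lambda_{\max}=\lambda_{n}=\max_{\substack{y^{*}x\neq 0\\ y=(VV^{*})^{-1}x}} \frac{y^{*}Ax}{y^{*}x}=\max_{\substack{y^{*}x=1\\ y=(VV^{*})^{-1}x}}y^{*}Ax;$$ (3) $$\lambda_{\min}=\lambda_{1}=\min_{\substack{y^{*}x\neq 0\\ y=(VV^{*})^{-1}x}} \frac{y^{*}Ax}{y^{*}x}=\min_{\substack{y^{*}x=1\\ y=(VV^{*})^{-1}x}}y^{*}Ax.$$ Here the maxima and minima are over pairs $x,y\in\mathbb{C}^n$ satisfying the indicated constraints.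
   Context: $X^{*}$ denotes the conjugate transpose; vectors are column vectors. $\lambda_{\max}$ and $\lambda_{\min}$ denote the largest and smallest eigenvalues of $A$. *)

(* Defs.v *)
From HB Require Import structures.
From mathcomp Require Import all_boot all_order all_algebra.
From mathcomp Require Import classical_sets reals complex.

Set Implicit Arguments.
Unset Strict Implicit.
Unset Printing Implicit Defensive.

Import Order.TTheory GRing.Theory Num.Theory.
Local Open Scope classical_set_scope.
Local Open Scope ring_scope.
Local Open Scope complex_scope.
Local Open Scope sesquilinear_scope.

(* Attained extrema. On R[i] the order is z <= w iff w - z is a nonnegative
   real; so if m is real and is_max S m or is_min S m holds, then all elements
   of S are real. *)
Definition is_max d (T : porderType d) (S : set T) (m : T) : Prop :=
  S m /\ ubound S m.

Definition is_min d (T : porderType d) (S : set T) (m : T) : Prop :=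
  S m /\ lbound S m.

(* The scalar y^* x for column vectors. *)
Definition cdot (R : realType) n (y x : 'cV[R[i]]_n) : R[i] :=
  (y^t* *m x) 0 0.

Definition quotient_values (R : realType) n (A V : 'M[R[i]]_n) : set R[i] :=
  [set z | exists x y : 'cV[R[i]]_n,
    [/\ y = invmx (V *m V^t*) *m x, cdot y x != 0
      & z = cdot y (A *m x) / cdot y x]].

Definition normalized_values (R : realType) n (A V : 'M[R[i]]_n) : set R[i] :=
  [set z | exists x y : 'cV[R[i]]_n,
    [/\ y = invmx (V *m V^t*) *m x, cdot y x = 1 & z = cdot y (A *m x)]].

(* Main.v *)
Require Import Defs.
From HB Require Import structures.
From mathcomp Require Import all_boot all_order all_algebra.
From mathcomp Require Import classical_sets reals complex.

Import Order.TTheory GRing.Theory Num.Theory.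
Local Open Scope classical_set_scope.
Local Open Scope ring_scope.
Local Open Scope complex_scope.
Local Open Scope sesquilinear_scope.

Set Implicit Arguments.
Unset Strict Implicit.
Unset Printing Implicit Defensive.

(** The Hermitian form x |-> y^* x with y = (V V^* )^-1 x is the standard inner
    product in the coordinates w = V^-1 x: as (V V^* )^-1 = (V^-1)^* V^-1, one
    has y^* z = w^* (V^-1 z) for every z ([cdot_invmx_gram]). In these
    coordinates A becomes its diagonal form, so
      y^* x = sum_i |w_i|^2   and   y^* A x = sum_i lam_i |w_i|^2,
    although A itself is not Hermitian ([cdot_eigencoord]).

    Hence y^* A x is a combination of the eigenvalues with nonnegative weights
    of total mass y^* x. Comparing termwise with the extreme eigenvalues gives
    the two inequalities ([weighted_sum_bounds]), and dividing by
    y^* x > 0 bounds all quotients. The bounds are attained at the columns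
    x = V e_k, for which the weights concentrate on the single index k
    ([normalized_values_eigenvalue]). Finally the spectrum of A is exactly the
    set of the lam_i ([eigenvalue_similar_diag]), so the extreme lam_i are
    also the extreme eigenvalues. *)

Lemma invmx_gram (R : realType) (n : nat) (V : 'M[R[i]]_n) :
  V \in unitmx -> invmx (V *m V^t*) = (invmx V)^t* *m invmx V.
Proof.
move=> Vu.
have VVu : V *m V^t* \in unitmx.
  by rewrite unitmx_mul Vu map_unitmx unitmx_tr.
have gramV : (invmx V)^t* *m invmx V *m (V *m V^t*) = 1%:M.
  rewrite mulmxA mulmxKV // -map_mxM -trmx_mul mulmxV //.
  by rewrite trmx1 map_mx1.
by rewrite -[RHS](mulmxK VVu) gramV mul1mx.
Qed.

(** The change of variables w = V^-1 x turns the form attached to V into the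
    standard inner product. *)
Lemma cdot_invmx_gram (R : realType) (n : nat) (V : 'M[R[i]]_n)
    (x z : 'cV[R[i]]_n) :
  V \in unitmx ->
  cdot (invmx (V *m V^t*) *m x) z = cdot (invmx V *m x) (invmx V *m z).
Proof.
move=> Vu; rewrite /cdot invmx_gram // -!mulmxA trmx_mul map_mxM.
by rewrite -!mulmxA trmxCK.
Qed.

Lemma cdot_diag (R : realType) (n : nat) (d : 'rV[R[i]]_n)
    (w : 'cV[R[i]]_n) :
  cdot w (diag_mx d *m w) = \sum_i d 0 i * `|w i 0| ^+ 2.
Proof.
rewrite /cdot mul_diag_mx mxE; apply: eq_bigr => i _.
by rewrite !mxE normCKC mulrCA.
Qed.

Lemma cdot_self (R : realType) (n : nat) (w : 'cV[R[i]]_n) :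
  cdot w w = \sum_i `|w i 0| ^+ 2.
Proof.
by rewrite /cdot mxE; apply: eq_bigr => i _; rewrite !mxE normCKC.
Qed.

Lemma cdot_self_ge0 (R : realType) (n : nat) (w : 'cV[R[i]]_n) :
  0 <= cdot w w.
Proof. by rewrite cdot_self sumr_ge0 // => i _; rewrite exprn_ge0. Qed.

Lemma invmx_intertwine (R : realType) (n : nat) (A V : 'M[R[i]]_n)
    (lam : 'rV[R[i]]_n) :
  V \in unitmx -> invmx V *m A *m V = diag_mx lam ->
  invmx V *m A = diag_mx lam *m invmx V.
Proof. by move=> V_unit <-; rewrite mulmxK. Qed.

Lemma mulmx_intertwine (R : realType) (n : nat) (A V : 'M[R[i]]_n)
    (lam : 'rV[R[i]]_n) :
  V \in unitmx -> invmx V *m A *m V = diag_mx lam ->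
  A *m V = V *m diag_mx lam.
Proof. by move=> V_unit <-; rewrite -mulmxA mulKVmx. Qed.

Lemma cdot_eigencoord (R : realType) (n : nat) (A V : 'M[R[i]]_n)
    (lam : 'rV[R[i]]_n) (x : 'cV[R[i]]_n) :
  V \in unitmx -> invmx V *m A *m V = diag_mx lam ->
  cdot (invmx (V *m V^t*) *m x) (A *m x) =
  \sum_i lam 0 i * `|(invmx V *m x) i 0| ^+ 2.
Proof.
move=> V_unit V_diag.
by rewrite cdot_invmx_gram // mulmxA (invmx_intertwine V_unit V_diag)
  -mulmxA cdot_diag.
Qed.

(** Both inclusions come from row vectors, since [eigenvalue] refers to left
    eigenvectors: multiplying one by V gives an eigenvector of the diagonal
    matrix, any nonzero entry of which identifies its eigenvalue; conversely
    row i of V^-1 belongs to lam_i. *)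
Lemma eigenvalue_similar_diag (R : realType) (n : nat) (A V : 'M[R[i]]_n)
    (lam : 'rV[R[i]]_n) (a : R[i]) :
  V \in unitmx -> invmx V *m A *m V = diag_mx lam ->
  eigenvalue A a <-> exists i, a = lam 0 i.
Proof.
move=> V_unit V_diag; split=> [/eigenvalueP[v vA v0]|[i ->]].
  have /eqP/rowP vVl : v *m V *m diag_mx lam == a *: (v *m V).
    by rewrite -mulmxA -(mulmx_intertwine V_unit V_diag) mulmxA vA scalemxAl.
  have /rV0Pn[i vVi] : v *m V != 0.
    by apply: contra v0 => /eqP vV0; rewrite -[v](mulmxK V_unit) vV0 mul0mx.
  exists i; apply: (mulIf vVi).
  by have := vVl i; rewrite mul_mx_diag [LHS]mxE [RHS]mxE mulrC.
apply/eigenvalueP; exists (row i (invmx V)).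
  by rewrite -row_mul (invmx_intertwine V_unit V_diag) row_mul row_diag_mx
    -scalemxAl -rowE.
apply/eqP => row0; have /rowP/(_ i)/eqP : row i (invmx V *m V) = 0.
  by rewrite row_mul row0 mul0mx.
by rewrite mulVmx // !mxE eqxx oner_eq0.
Qed.

(** The witness is the eigenvector V e_k, already normalized because its
    coordinate vector is e_k. *)
Lemma normalized_values_eigenvalue (R : realType) (n : nat) (A V : 'M[R[i]]_n)
    (lam : 'rV[R[i]]_n) (k : 'I_n) :
  V \in unitmx -> invmx V *m A *m V = diag_mx lam ->
  normalized_values A V (lam 0 k).
Proof.
move=> V_unit V_diag.
have wE : invmx V *m (V *m delta_mx k 0) = delta_mx k 0 :> 'cV_n.
  by rewrite mulKmx.
have weight i : `|(delta_mx k 0 : 'cV[R[i]]_n) i 0| ^+ 2 = (i == k)%:R.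
  rewrite mxE eqxx andbT.
  by case: eqP => _; rewrite ?normr1 ?normr0 ?expr1n ?expr0n.
exists (V *m delta_mx k 0), (invmx (V *m V^t*) *m (V *m delta_mx k 0)).
split=> //.
  rewrite cdot_invmx_gram // wE cdot_self (bigD1 k) //= weight eqxx big1 ?addr0 //.
  by move=> i /negPf ik; rewrite weight ik.
rewrite (cdot_eigencoord _ V_unit V_diag) wE (bigD1 k) //= weight eqxx mulr1 big1 ?addr0 //.
by move=> i /negPf ik; rewrite weight ik mulr0.
Qed.

Lemma weighted_sum_bounds (K : numDomainType) (n : nat) (l p : 'I_n -> K)
    (a b : K) :
  (forall i, 0 <= p i) -> (forall i, a <= l i <= b) ->
  a * (\sum_i p i) <= \sum_i l i * p i <= b * (\sum_i p i).
Proof.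
move=> p0 lab; rewrite !mulr_sumr.
apply/andP; split; apply: ler_sum => i _; case/andP: (lab i) => al lb;
  exact: ler_wpM2r.
Qed.

Lemma normalized_sub_quotient (R : realType) (n : nat) (A V : 'M[R[i]]_n) :
  normalized_values A V `<=` quotient_values A V.
Proof.
move=> z [x [y [yE c1 zE]]]; exists x, y.
by split; rewrite // c1 ?oner_neq0 // divr1.
Qed.

Theorem theorem4p5 (R : realType) (n : nat) (A V : 'M[R[i]]_n.+1)
    (lam : 'rV[R[i]]_n.+1)
    (A_nonherm : A \isn't hermsymmx)
    (A_diagonalizable : diagonalizable A)
    (V_unit : V \in unitmx)
    (V_diag : invmx V *m A *m V = diag_mx lam)
    (lam_real : forall i, lam 0 i \is Num.real)
    (lam_sorted : forall i j : 'I_n.+1, (i <= j)%N -> lam 0 i <= lam 0 j) :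
  [/\ forall x y : 'cV[R[i]]_n.+1, y = invmx (V *m V^t*) *m x ->
        [/\ cdot y x \is Num.real, cdot y (A *m x) \is Num.real,
            lam 0 ord0 * cdot y x <= cdot y (A *m x)
          & cdot y (A *m x) <= lam 0 ord_max * cdot y x],
      [/\ is_max [set a | eigenvalue A a] (lam 0 ord_max),
          is_max (quotient_values A V) (lam 0 ord_max)
        & is_max (normalized_values A V) (lam 0 ord_max)]
    & [/\ is_min [set a | eigenvalue A a] (lam 0 ord0),
          is_min (quotient_values A V) (lam 0 ord0)
        & is_min (normalized_values A V) (lam 0 ord0)]].
Proof.
have lamP i : lam 0 ord0 <= lam 0 i <= lam 0 ord_max.
  by rewrite !lam_sorted // leq_ord.
have form_ge0 x : 0 <= cdot (invmx (V *m V^t*) *m x) x.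
  by rewrite cdot_invmx_gram // cdot_self_ge0.
have form_bounds x : lam 0 ord0 * cdot (invmx (V *m V^t*) *m x) x
    <= cdot (invmx (V *m V^t*) *m x) (A *m x)
    <= lam 0 ord_max * cdot (invmx (V *m V^t*) *m x) x.
  rewrite (cdot_eigencoord _ V_unit V_diag) cdot_invmx_gram // cdot_self.
  by apply: weighted_sum_bounds => // i; rewrite exprn_ge0.
have spec_bounds a : eigenvalue A a -> lam 0 ord0 <= a <= lam 0 ord_max.
  by move=> /(eigenvalue_similar_diag _ V_unit V_diag)[i ->].
have spec_mem k : eigenvalue A (lam 0 k).
  by apply/(eigenvalue_similar_diag _ V_unit V_diag); exists k.
have quot_bounds z : quotient_values A V z ->
    lam 0 ord0 <= z <= lam 0 ord_max.
  move=> [x [y [-> c0 ->]]].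
  have c_gt0 : 0 < cdot (invmx (V *m V^t*) *m x) x by rewrite lt0r c0 form_ge0.
  by rewrite ler_pdivlMr // ler_pdivrMr.
have norm_mem k : normalized_values A V (lam 0 k).
  exact: normalized_values_eigenvalue V_unit V_diag.
have quot_mem k := normalized_sub_quotient (norm_mem k).
have norm_bounds z (Nz : normalized_values A V z) :=
  quot_bounds z (normalized_sub_quotient Nz).
have extrema S : (forall k, S (lam 0 k)) ->
    (forall z, S z -> lam 0 ord0 <= z <= lam 0 ord_max) ->
    is_max S (lam 0 ord_max) /\ is_min S (lam 0 ord0).
  by move=> mem bnd; split; split=> // z /bnd/andP[].
have [spec_max spec_min] := extrema [set a | eigenvalue A a] spec_mem spec_bounds.
have [quot_max quot_min] := extrema _ quot_mem quot_bounds.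
have [norm_max norm_min] := extrema _ norm_mem norm_bounds.
split=> // x _ ->; case/andP: (form_bounds x) => lo hi; split => //.
  exact: ger0_real.
rewrite (cdot_eigencoord _ V_unit V_diag) rpred_sum // => i _.
by rewrite realM // realX // normr_real.
Qed.
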